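(* The linear map $\zeta_{\mathrm{FS}}:\mathcal{W}_{\mathbb{N}^*}\to\mathcal{S}_{\mathbb{N}^*}$ defined by $\zeta_{\mathrm{FS}}(\emptyset)=\emptyset\otimes\emptyset\times F$ and $$\zeta_{\mathrm{FS}}(\omega_1\cdots\omega_k)=\sum_{1\le n_k<\dots<n_1}\prod_{i=1}^k f_{\omega_i}$$ is a morphism of (augmented) tridendriform algebras.
   Context: All vector spaces are over $\mathbb{R}$. **Tridendriform algebras.** A tridendriform algebra is a vector space $A$ with bilinear operations $\prec,\cdot,\succ$ such that, with $x*y:=x\prec y+x\cdot y+x\succ y$, for all $x,y,z\in A$: $(x\prec y)\prec z=x\prec(y*z)$; $(x\succ y)\prec z=x\succ(y\prec z)$; $(x*y)\succ z=x\succ(y\succ z)$; $(x\succ y)\cdot z=x\succ(y\cdot z)$; $(x\prec y)\cdot z=x\cdot(y\succ z)$; $(x\cdot y)\prec z=x\cdot(y\prec z)$; $(x\cdot y)\cdot z=x\cdot(y\cdot z)$. The augmented tridendriform algebra is $\overline A=A\oplus\mathbb{R}1$, with products extended by $1\prec a=0=a\succ1$, $a\prec1=a=1\succ a$, $a\cdot1=0=1\cdot a$ for $a\in A$ (and $1*1=1$). A morphism of augmented tridendriform algebras is a linear map sending $1$ to $1$, $A$ to $B$, and preserving $\prec,\succ,\cdot$ on $A$. **Words.** $\mathbb{N}^*=\{1,2,\dots\}$; $\mathcal{W}_{\mathbb{N}^*}$ is the vector space with basis the finite words on the alphabet $\mathbb{N}^*$, with $\emptyset$ the empty word. The quasi-shuffle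 product $\overline{⧢}$ (written here $\star_q$) is defined by $u\star_q\emptyset=\emptyset\star_q u=u$ and, for nonempty $u=u_1\cdots u_n$, $v=v_1\cdots v_k$, $u\star_q v=u\prec v+u\succ v+u\cdot v$ with $u\prec v=u_1(u_2\cdots u_n\star_q v)$, $u\succ v=v_1(u\star_q v_2\cdots v_k)$, $u\cdot v=(u_1+v_1)(u_2\cdots u_n\star_q v_2\cdots v_k)$. This makes $\mathcal{W}_{\mathbb{N}^*}$ an augmented tridendriform algebra with unit $\emptyset$. **Formal series.** For $d\in\mathbb{N}$, let $\mathbb{R}\mathcal{P}(\mathbb{N}^d)$ be the vector space with basis the power set of $\mathbb{N}^d$, an algebra for the bilinear extension of $\cup$, and $J_d$ its ideal generated by all $A\cup B-A-B+A\cap B$. A formal series is a pair $(A\otimes w,F)$ in $\big\langle(\mathbb{R}\mathcal{P}(\mathbb{N}^{\ell(w)})/J_{\ell(w)})\otimes w\mid w\text{ a word in }\mathbb{N}^*\big\rangle\times(\mathbb{N}^*\to\mathbb{R})^{\mathbb{N}^*}$ ($\ell$ = length), also written $A\otimes w\times F$ or $\sum_A\prod_i f_{w_i}$ with $f_n:=F(n)$. Here $F$ is fixed: $f_k=F(k)=(n\mapsto n^{-k})$, and vector space operations are those of the first factor. $\mathcal{S}_{\mathbb{N}^*}$ is the subspace spanned by all $\sum_{1\le n_r<\dots<n_1}\prod_{i=1}^r f_{\omega_i}:=\{(n_1,\dots,n_r):1\le n_r<\dots<n_1\}\otimes\omega_1\cdots\omega_r\times F$, $r\ge0$; the element for $r=0$,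 $\emptyset\otimes\emptyset\times F$, is the unit. **Products on $\mathcal{S}_{\mathbb{N}^*}$.** For $k,l\ge1$, $\mathrm{Qsh}(k,l)$ is the set of surjections $\sigma:\{1,\dots,k+l\}\to\{1,\dots,n\}$ (some $n=\max(\sigma)$) with $\sigma(1)<\dots<\sigma(k)$ and $\sigma(k+1)<\dots<\sigma(k+l)$. For $\alpha=\sum_{1\le n_k<\dots<n_1}\prod_{i=1}^k f_{\omega_i}$ and $\beta=\sum_{1\le n_{k+l}<\dots<n_{k+1}}\prod_{i=k+1}^{k+l}f_{\omega_i}$ with $k,l\geq 1$, each of $\alpha\prec\beta$, $\alpha\succ\beta$, $\alpha\cdot\beta$ is $\sum_\sigma\sum_{1\le n_{\max(\sigma)}<\dots<n_1}\prod_{i=1}^{\max(\sigma)}f_{\omega_{\sigma^{-1}(\{i\})}}$, where $\sigma$ runs over elements of $\mathrm{Qsh}(k,l)$ with, respectively, $\sigma^{-1}(\{1\})=\{1\}$, $\{k+1\}$, $\{1,k+1\}$, and $\omega_{\{i\}}=\omega_i$, $\omega_{\{i,j\}}=\omega_i+\omega_j$. With these, $\mathcal{S}_{\mathbb{N}^*}$ is an augmented tridendriform algebra. *)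

(* Defs.v *)
From HB Require Import structures.
From mathcomp Require Import all_boot all_order all_algebra.
From mathcomp Require Import finmap ring_quotient.
From mathcomp Require Import boolp classical_sets cardinality reals.
From mathcomp Require Import monalg.

Set Implicit Arguments.
Unset Strict Implicit.
Unset Printing Implicit Defensive.

Import GRing.Theory.

Local Open Scope classical_set_scope.
Local Open Scope ring_scope.
Local Open Scope quotient_scope.

(* {malg R[K]} is the free R-module on the choice type K, with basis <<k>>. *)
Section LinearExtension.
Context (R : nzRingType) (K : choiceType) (V : lmodType R).

Definition lin_ext (g : K -> V) (x : {malg R[K]}) : V :=
  \sum_(k <- msupp x) x@_k *: g k.

Definition bilin_ext (g : K -> K -> V) (x y : {malg R[K]}) : V :=
  lin_ext (fun k => lin_ext (g k) y) x.

Definition span_of (P : set K) (g : K -> V) : set V :=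
  [set v | exists2 x : {malg R[K]},
     (forall k, k \in msupp x -> P k) & v = lin_ext g x].

Lemma lin_extEw (g : K -> V) (d : {fset K}) (x : {malg R[K]}) :
  (msupp x `<=` d)%fset -> lin_ext g x = \sum_(k <- d) x@_k *: g k.
Proof.
move=> le; rewrite /lin_ext (big_fset_incl _ le) // => k _ /mcoeff_outdom ->.
by rewrite scale0r.
Qed.

Lemma lin_ext_linear (g : K -> V) : linear (lin_ext g).
Proof.
move=> a x y; pose d := (msupp x `|` msupp y)%fset.
rewrite (@lin_extEw g d x) ?fsubsetUl // (@lin_extEw g d y) ?fsubsetUr //.
rewrite (@lin_extEw g d); last first.
  apply: (fsubset_trans (msuppD_le _ _)).
  by rewrite fsetSU // msuppZ_le.
rewrite scaler_sumr -big_split; apply: eq_bigr => k _ /=.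
by rewrite mcoeffD mcoeffZ scalerDl scalerA.
Qed.

HB.instance Definition _ (g : K -> V) :=
  GRing.isLinear.Build R {malg R[K]} V *:%R (lin_ext g) (lin_ext_linear g).

Lemma lin_extU (g : K -> V) (k : K) : lin_ext g <<k>> = g k.
Proof. by rewrite (lin_extEw _ msuppU_le) big_seq_fset1 mcoeffUU scale1r. Qed.

Lemma bilin_extU (g : K -> K -> V) (k l : K) : bilin_ext g <<k>> <<l>> = g k l.
Proof. by rewrite /bilin_ext !lin_extU. Qed.

End LinearExtension.

Section Tridendriform.
Context (R : nzRingType).

Definition subspace (V : lmodType R) (A : set V) : Prop :=
  A 0 /\ forall (a : R) (x y : V), A x -> A y -> A (a *: x + y).

Definition bilinear_op (V : lmodType R) (op : V -> V -> V) : Prop :=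
  (forall y, linear (op^~ y)) /\ (forall x, linear (op x)).

(* The tridendriform axioms for the restrictions of the operations to A. *)
Record tridendriform_on (V : lmodType R) (A : set V)
    (prec dot succ : V -> V -> V) : Prop := {
  prec_closed : forall x y, A x -> A y -> A (prec x y);
  dot_closed  : forall x y, A x -> A y -> A (dot x y);
  succ_closed : forall x y, A x -> A y -> A (succ x y);
  prec_prec : forall x y z, A x -> A y -> A z ->
    prec (prec x y) z = prec x (prec y z + dot y z + succ y z);
  succ_prec : forall x y z, A x -> A y -> A z ->
    prec (succ x y) z = succ x (prec y z);
  succ_succ : forall x y z, A x -> A y -> A z ->
    succ (prec x y + dot x y + succ x y) z = succ x (succ y z);
  succ_dot : forall x y z, A x -> A y -> A z ->
    dot (succ x y) z = succ x (dot y z);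
  prec_dot : forall x y z, A x -> A y -> A z ->
    dot (prec x y) z = dot x (succ y z);
  dot_prec : forall x y z, A x -> A y -> A z ->
    prec (dot x y) z = dot x (prec y z);
  dot_dot : forall x y z, A x -> A y -> A z ->
    dot (dot x y) z = dot x (dot y z)
}.

(* The underlying data of an augmented tridendriform algebra A (+) R 1:
   [at_aug] is the subspace A and [at_one] is 1. *)
Record augTridendData := AugTridendData {
  at_space :> lmodType R;
  at_one : at_space;
  at_aug : set at_space;
  at_prec : at_space -> at_space -> at_space;
  at_dot : at_space -> at_space -> at_space;
  at_succ : at_space -> at_space -> at_space;
  at_star : at_space -> at_space -> at_space
}.

(* The values of prec, dot and succ at (1, 1) are left unspecified: only
   1 * 1 = 1 is required. *)
Record aug_tridendriform (T : augTridendData) : Prop := {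
  aug_subspace : subspace (@at_aug T);
  aug_one : ~ at_aug (at_one T);
  aug_decomp : forall x : T, exists a (c : R), at_aug a /\ x = a + c *: at_one T;
  prec_bilinear : bilinear_op (@at_prec T);
  dot_bilinear  : bilinear_op (@at_dot T);
  succ_bilinear : bilinear_op (@at_succ T);
  star_bilinear : bilinear_op (@at_star T);
  aug_tridend : tridendriform_on (@at_aug T) (@at_prec T) (@at_dot T) (@at_succ T);
  star_sum : forall x y : T, at_aug x -> at_aug y ->
    at_star x y = at_prec x y + at_dot x y + at_succ x y;
  one_prec : forall a : T, at_aug a -> at_prec (at_one T) a = 0;
  prec_one : forall a : T, at_aug a -> at_prec a (at_one T) = a;
  one_dot  : forall a : T, at_aug a -> at_dot (at_one T) a = 0;
  dot_one  : forall a : T, at_aug a -> at_dot a (at_one T) = 0;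
  one_succ : forall a : T, at_aug a -> at_succ (at_one T) a = a;
  succ_one : forall a : T, at_aug a -> at_succ a (at_one T) = 0;
  one_star : forall x : T, at_star (at_one T) x = x;
  star_one : forall x : T, at_star x (at_one T) = x
}.

Record aug_tridend_morphism (T U : augTridendData) (f : T -> U) : Prop := {
  mor_linear : linear f;
  mor_one  : f (at_one T) = at_one U;
  mor_aug  : forall x : T, at_aug x -> at_aug (f x);
  mor_prec : forall x y : T, at_aug x -> at_aug y ->
    f (at_prec x y) = at_prec (f x) (f y);
  mor_succ : forall x y : T, at_aug x -> at_aug y ->
    f (at_succ x y) = at_succ (f x) (f y);
  mor_dot  : forall x y : T, at_aug x -> at_aug y ->
    f (at_dot x y) = at_dot (f x) (f y)
}.

End Tridendriform.

Definition pnat := {n : nat | (0 < n)%N}.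

Lemma pnat_add_subproof (m n : pnat) : (0 < val m + val n)%N.
Proof. by rewrite addn_gt0 (valP m). Qed.

Definition pnat_add (m n : pnat) : pnat := Sub (val m + val n)%N (pnat_add_subproof m n).

Definition pnat1 : pnat := Sub 1%N isT.

(* Sum of a nonempty list of letters; the value on the empty list is junk. *)
Definition pnat_sum (s : seq pnat) : pnat :=
  if s is a :: s' then foldl pnat_add a s' else pnat1.

Definition word := seq pnat.

Section Words.
Context (R : nzRingType).

Definition words := {malg R[word]}.

Definition wcons (a : pnat) : words -> words :=
  lin_ext (fun w : word => <<a :: w>> : words).

Fixpoint qshuffle (u : word) : word -> words :=
  fix qshuffle_u (v : word) : words :=
    match u, v with
    | [::], _ => << v >>
    | _, [::] => << u >>
    | a :: u', b :: v' =>
        wcons a (qshuffle u' v) + wcons b (qshuffle_u v')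
        + wcons (pnat_add a b) (qshuffle u' v')
    end.

Definition wprec (u v : word) : words :=
  match u, v with
  | [::], _ => 0
  | _, [::] => << u >>
  | a :: u', _ => wcons a (qshuffle u' v)
  end.

Definition wsucc (u v : word) : words :=
  match u, v with
  | _, [::] => 0
  | [::], _ => << v >>
  | _, b :: v' => wcons b (qshuffle u v')
  end.

Definition wdot (u v : word) : words :=
  match u, v with
  | a :: u', b :: v' => wcons (pnat_add a b) (qshuffle u' v')
  | _, _ => 0
  end.

Definition words_tridend : augTridendData R := {|
  at_space := words;
  at_one := << [::] >>;
  at_aug := span_of [set w | w <> [::]] (fun w : word => << w >> : words);
  at_prec := bilin_ext wprec;
  at_dot := bilin_ext wdot;
  at_succ := bilin_ext wsucc;
  at_star := bilin_ext qshuffle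
|}.

End Words.

(* The subsets of N^d, as a commutative monoid for the union; the monoid algebra
   {malg R[subsets d]} is then R P(N^d). *)
Definition subsets (d : nat) : Type := set (d.-tuple nat).

HB.instance Definition _ d := Choice.copy (subsets d) (set (d.-tuple nat)).

Lemma subsets_unitm d (A B : subsets d) :
  A `|` B = set0 -> A = set0 /\ B = set0.
Proof. by rewrite setU_eq0. Qed.

HB.instance Definition _ d := Choice_isMonomialDef.Build (subsets d)
  (@setUA (d.-tuple nat)) (@set0U (d.-tuple nat)) (@setU0 (d.-tuple nat))
  (@subsets_unitm d).
HB.instance Definition _ d := MonomialDef_isConomialDef.Build (subsets d)
  (@setUC (d.-tuple nat)).

Section PowersetQuotient.
Context (R : comNzRingType) (d : nat).

Definition powset_alg := {malg R[subsets d]}.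

Definition is_ideal (I : set powset_alg) : Prop :=
  [/\ I 0, forall x y, I x -> I y -> I (x + y) & forall a x, I x -> I (a * x)].

Definition incl_excl : set powset_alg :=
  [set x | exists A B : subsets d,
     x = << (A `|` B : subsets d) >> - << A >> - << B >>
         + << (A `&` B : subsets d) >>].

Definition J : set powset_alg := smallest is_ideal incl_excl.

Definition J_pred : {pred powset_alg} := fun x => `[< J x >].

Lemma J_is_ideal : is_ideal J.
Proof.
split=> [I [[I0 _ _] _]//|x y Jx Jy I HI|a x Jx I HI].
- by have [[_ ID _] _] := HI; apply: ID; [exact: Jx|exact: Jy].
- by have [[_ _ IM] _] := HI; apply: IM; exact: Jx.
Qed.

Definition mass (x : powset_alg) : R := lin_ext (fun _ => 1 : R^o) x.

Lemma massU A : mass << A >> = 1.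
Proof. by rewrite /mass lin_extU. Qed.

Lemma massM x y : mass (x * y) = mass x * mass y.
Proof.
have massE z : mass z = \sum_(A <- msupp z) z@_A.
  by apply: eq_bigr => A _; apply: mulr1.
rewrite malgME {1}/mass linear_sum !massE mulr_suml; apply: eq_bigr => A _.
rewrite linear_sum mulr_sumr; apply: eq_bigr => B _ /=.
by rewrite (lin_extEw _ msuppU_le) big_seq_fset1 mcoeffUU; apply: mulr1.
Qed.

Lemma mass_J x : J x -> mass x = 0.
Proof.
move=> Jx; apply: (Jx [set y | mass y = 0]); split; first split=> [|y z my mz|a y my].
- by rewrite /= /mass linear0.
- by rewrite /= /mass linearD [X in X + _]my [X in _ + X]mz addr0.
- by rewrite /= massM [mass y]my mulr0.
move=> _ [A [B ->]]; rewrite /= /mass linearD !linearB /= !lin_extU.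
by rewrite subrr sub0r addNr.
Qed.

Lemma J_zmod_closed : zmod_closed J_pred.
Proof.
have [J0 JD JM] := J_is_ideal.
split=> [|x y /asboolP Jx /asboolP Jy]; apply/asboolP => //.
by apply: JD => //; rewrite -mulN1r; apply: JM.
Qed.

HB.instance Definition _ := GRing.isZmodClosed.Build powset_alg J_pred
  J_zmod_closed.

Definition powset_quot : Type := Quotient.quot J_pred.

HB.instance Definition _ := GRing.Zmodule.on powset_quot.

Definition pq_class (x : powset_alg) : powset_quot := \pi_(Quotient.quot J_pred) x.

Lemma pq_classP x y : pq_class x = pq_class y <-> J (x - y).
Proof.
rewrite /pq_class; split=> [/eqP|Jxy].
  by rewrite -Quotient.idealrBE => /asboolP.
by apply/eqP; rewrite -Quotient.idealrBE; apply/asboolP.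
Qed.

Lemma pq_classK (q : powset_quot) : pq_class (repr (q : Quotient.quot J_pred)) = q.
Proof. exact: (@reprK _ (Quotient.quot J_pred)). Qed.

Lemma pq_classD x y : pq_class (x + y) = pq_class x + pq_class y.
Proof. exact: Quotient.pi_add. Qed.

Definition pq_scale (a : R) (q : powset_quot) : powset_quot :=
  pq_class (a *: repr (q : Quotient.quot J_pred)).

Lemma pq_scaleE a x : pq_scale a (pq_class x) = pq_class (a *: x).
Proof.
apply/pq_classP; rewrite -scalerBr -mul_malgC.
have [_ _ JM] := J_is_ideal.
have Jx : J (repr (pq_class x : Quotient.quot J_pred) - x).
  by apply/pq_classP; apply: pq_classK.
exact: (JM _ _ Jx).
Qed.

Definition pq_mass (q : powset_quot) : R :=
  mass (repr (q : Quotient.quot J_pred)).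

Lemma pq_massE x : pq_mass (pq_class x) = mass x.
Proof.
have /mass_J : J (repr (pq_class x : Quotient.quot J_pred) - x).
  by apply/pq_classP; apply: pq_classK.
by rewrite /pq_mass /mass linearB => /eqP; rewrite subr_eq0 => /eqP.
Qed.

Lemma pq_scaleA a b q : pq_scale a (pq_scale b q) = pq_scale (a * b) q.
Proof. by rewrite -(pq_classK q) !pq_scaleE scalerA. Qed.

Lemma pq_scale1 : left_id 1 pq_scale.
Proof. by move=> q; rewrite -(pq_classK q) pq_scaleE scale1r. Qed.

Lemma pq_scaleDr : right_distributive pq_scale +%R.
Proof.
move=> a p q; rewrite -(pq_classK p) -(pq_classK q).
by rewrite -pq_classD !pq_scaleE -pq_classD scalerDr.
Qed.

Lemma pq_scaleDl q : {morph pq_scale^~ q : a b / a + b}.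
Proof.
by move=> a b; rewrite -(pq_classK q) /= !pq_scaleE -pq_classD scalerDl.
Qed.

HB.instance Definition _ := GRing.Zmodule_isLmodule.Build R powset_quot
  pq_scaleA pq_scale1 pq_scaleDr pq_scaleDl.

Lemma pq_mass_linear : linear (pq_mass : powset_quot -> R^o).
Proof.
move=> a p q; rewrite -(pq_classK p) -(pq_classK q).
rewrite -[a *: _]/(pq_scale a _) pq_scaleE -pq_classD !pq_massE.
by rewrite /mass linearP.
Qed.

HB.instance Definition _ := GRing.isLinear.Build R powset_quot R^o *:%R
  pq_mass pq_mass_linear.

End PowersetQuotient.

Section DirectSum.
Context (R : nzRingType) (I : choiceType) (Q : I -> lmodType R).

Definition dprod : Type := forall i, Q i.

HB.instance Definition _ := Choice.copy dprod (forall i, Q i).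

Definition dprod_zero : dprod := fun i => 0.
Definition dprod_opp (f : dprod) : dprod := fun i => - f i.
Definition dprod_add (f g : dprod) : dprod := fun i => f i + g i.
Definition dprod_scale (a : R) (f : dprod) : dprod := fun i => a *: f i.

Lemma dprod_addA : associative dprod_add.
Proof. by move=> f g h; apply: functional_extensionality_dep => i; apply: addrA. Qed.

Lemma dprod_addC : commutative dprod_add.
Proof. by move=> f g; apply: functional_extensionality_dep => i; apply: addrC. Qed.

Lemma dprod_add0 : left_id dprod_zero dprod_add.
Proof. by move=> f; apply: functional_extensionality_dep => i; apply: add0r. Qed.

Lemma dprod_addN : left_inverse dprod_zero dprod_opp dprod_add.
Proof. by move=> f; apply: functional_extensionality_dep => i; apply: addNr. Qed.

HB.instance Definition _ := GRing.isZmodule.Build dprod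
  dprod_addA dprod_addC dprod_add0 dprod_addN.

Lemma dprod_scaleA a b f : dprod_scale a (dprod_scale b f) = dprod_scale (a * b) f.
Proof. by apply: functional_extensionality_dep => i; apply: scalerA. Qed.

Lemma dprod_scale1 : left_id 1 dprod_scale.
Proof. by move=> f; apply: functional_extensionality_dep => i; apply: scale1r. Qed.

Lemma dprod_scaleDr : right_distributive dprod_scale +%R.
Proof.
by move=> a f g; apply: functional_extensionality_dep => i; apply: scalerDr.
Qed.

Lemma dprod_scaleDl f : {morph dprod_scale^~ f : a b / a + b}.
Proof.
by move=> a b; apply: functional_extensionality_dep => i; apply: scalerDl.
Qed.

HB.instance Definition _ := GRing.Zmodule_isLmodule.Build R dprod
  dprod_scaleA dprod_scale1 dprod_scaleDr dprod_scaleDl.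

Definition finite_support : {pred dprod} :=
  fun f => `[< finite_set [set i | f i <> 0] >].

Lemma finite_support_submod : submod_closed finite_support.
Proof.
split=> [|a f g /asboolP fin_f /asboolP fin_g]; apply/asboolP.
  by apply: sub_finite_set (@finite_set0 I) => i.
apply: (@sub_finite_set _ _ ([set i | f i <> 0] `|` [set i | g i <> 0])).
  move=> i /= nz; have [fi0|] := pselect (f i = 0); last by left.
  right=> gi0; apply: nz.
  by rewrite -[LHS]/(a *: f i + g i) fi0 gi0 scaler0 addr0.
by rewrite finite_setU.
Qed.

HB.instance Definition _ := GRing.isSubmodClosed.Build R dprod finite_support
  finite_support_submod.

Record dsum := DSum { dsum_val : dprod; _ : dsum_val \in finite_support }.

HB.instance Definition _ := [isSub for dsum_val].
HB.instance Definition _ := [Choice of dsum by <:].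
HB.instance Definition _ := [SubChoice_isSubLmodule of dsum by <:].

Definition dprod_single (i : I) (q : Q i) : dprod := fun j =>
  match pselect (i = j) with
  | left e => ecast k (Q k) e q
  | right _ => 0
  end.

Lemma dprod_single_support i q : @dprod_single i q \in finite_support.
Proof.
apply/asboolP; apply: sub_finite_set (finite_set1 i) => j /=.
by rewrite /dprod_single; case: pselect => [e _|]; [exact: esym e|].
Qed.

Definition dsum_single (i : I) (q : Q i) : dsum :=
  DSum (dprod_single_support q).

End DirectSum.

Section FormalSeries.
Context (R : comNzRingType).

Definition family := pnat -> pnat -> R.

Definition word_summand (w : word) : lmodType R := powset_quot R (size w).

Definition series_sum := dsum word_summand.

(* Formal series (x, F) with a given second component F. *)
Record fseries (F : family) := FSeries {
  fs_pair : series_sum * family;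
  _ : fs_pair.2 == F
}.
HB.instance Definition _ F := [isSub for @fs_pair F].
HB.instance Definition _ F := [Choice of fseries F by <:].

Section Module.
Context (F : family).
Implicit Types (s t : fseries F).

Definition fs_make (x : series_sum) : fseries F :=
  @FSeries F (x, F) (eqxx F).
Definition fs_term s : series_sum := (fs_pair s).1.

Lemma fs_termK : cancel fs_term fs_make.
Proof.
move=> s; apply: val_inj; rewrite [RHS]surjective_pairing; congr pair.
by symmetry; apply/eqP/(valP s).
Qed.

Definition fs_zero := fs_make 0.
Definition fs_opp s := fs_make (- fs_term s).
Definition fs_add s t := fs_make (fs_term s + fs_term t).
Definition fs_scale a s := fs_make (a *: fs_term s).

Lemma fs_addA : associative fs_add.
Proof. by move=> s t u; rewrite /fs_add addrA. Qed.

Lemma fs_addC : commutative fs_add.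
Proof. by move=> s t; rewrite /fs_add addrC. Qed.

Lemma fs_add0 : left_id fs_zero fs_add.
Proof. by move=> s; rewrite /fs_add add0r fs_termK. Qed.

Lemma fs_addN : left_inverse fs_zero fs_opp fs_add.
Proof. by move=> s; rewrite /fs_add addNr. Qed.

HB.instance Definition _ := GRing.isZmodule.Build (fseries F)
  fs_addA fs_addC fs_add0 fs_addN.

Lemma fs_scaleA a b s : fs_scale a (fs_scale b s) = fs_scale (a * b) s.
Proof. by rewrite /fs_scale scalerA. Qed.

Lemma fs_scale1 : left_id 1 fs_scale.
Proof. by move=> s; rewrite /fs_scale scale1r fs_termK. Qed.

Lemma fs_scaleDr : right_distributive fs_scale +%R.
Proof. by move=> a s t; rewrite /fs_scale scalerDr. Qed.

Lemma fs_scaleDl s : {morph fs_scale^~ s : a b / a + b}.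
Proof. by move=> a b; rewrite /fs_scale scalerDl. Qed.

HB.instance Definition _ := GRing.Zmodule_isLmodule.Build R (fseries F)
  fs_scaleA fs_scale1 fs_scaleDr fs_scaleDl.

(* The formal series (A \otimes w, F). *)
Definition fs_tensor (w : word) (A : subsets (size w)) : fseries F :=
  fs_make (@dsum_single R word word_summand w
             (pq_class (<< A >> : powset_alg R (size w)))).

End Module.

(* For r = 0 this is by convention the empty subset of N^0, not the full set
   {()}: the unit of S is the tensor of the empty set and the empty word. *)
Definition decr_tuples (r : nat) : subsets r :=
  if r is 0 then set0 else
  [set n : r.-tuple nat | (forall i, (1 <= tnth n i)%N) /\
     (forall i j : 'I_r, (i < j)%N -> (tnth n j < tnth n i)%N)].

Definition fs_decr (F : family) (w : word) : fseries F :=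
  fs_tensor F (@decr_tuples (size w)).

End FormalSeries.

Section ZetaSeries.
Context (R : realType).

Definition zeta_family : family R := fun k n => (val n)%:R ^- val k.

Definition zeta_series_pred : {pred fseries zeta_family} :=
  fun s => `[< span_of setT (fs_decr zeta_family) s >].

Lemma zeta_series_submod : submod_closed zeta_series_pred.
Proof.
split=> [|a s t /asboolP[x _ ->] /asboolP[y _ ->]]; apply/asboolP.
  by exists 0 => //; rewrite linear0.
by exists (a *: x + y) => //; rewrite linearP.
Qed.

HB.instance Definition _ := GRing.isSubmodClosed.Build R (fseries zeta_family)
  zeta_series_pred zeta_series_submod.

Record zeta_series :=
  ZetaSeries { zs_val : fseries zeta_family; _ : zs_val \in zeta_series_pred }.

HB.instance Definition _ := [isSub for zs_val].
HB.instance Definition _ := [Choice of zeta_series by <:].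
HB.instance Definition _ := [SubChoice_isSubLmodule of zeta_series by <:].

Lemma zs_decr_subproof (w : word) : fs_decr zeta_family w \in zeta_series_pred.
Proof. by apply/asboolP; exists << w >> => //; rewrite lin_extU. Qed.

(* \sum_(1 <= n_r < ... < n_1) \prod_i f_(w_i) *)
Definition zs_decr (w : word) : zeta_series := ZetaSeries (zs_decr_subproof w).

Lemma zs_span (s : zeta_series) : exists x : words R, s = lin_ext zs_decr x.
Proof.
have /asboolP[x _ e] := valP s; exists x; apply: val_inj.
rewrite [LHS]e /lin_ext raddf_sum; apply: eq_bigr => w _.
by [].
Qed.

Definition zs_mass (w : word) (s : zeta_series) : R :=
  pq_mass (dsum_val (fs_term (zs_val s)) w).

Lemma zs_mass_linear w : linear (zs_mass w : zeta_series -> R^o).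
Proof. by move=> a s t; rewrite /zs_mass /= -linearP. Qed.

HB.instance Definition _ w := GRing.isLinear.Build R zeta_series R^o *:%R
  (zs_mass w) (zs_mass_linear w).

Lemma zs_mass_decr w w' : zs_mass w (zs_decr w') = (w' == w)%:R.
Proof.
rewrite /zs_mass /= /dprod_single; case: pselect => [e|/eqP/negPf ->].
  by case: w / e => /=; rewrite eqxx pq_massE massU.
exact: (@linear0 _ _ _ _ (@pq_mass R (size w) : {linear _ -> R^o})).
Qed.

Lemma zs_mass_lin_ext w (x : words R) : zs_mass w (lin_ext zs_decr x) = x@_w.
Proof.
rewrite linear_sum [in RHS](monalgE x) raddf_sum; apply: eq_bigr => w' _.
by rewrite linearZ /= zs_mass_decr mcoeffU /GRing.scale /= mulr_natr.
Qed.

(* The coordinates of an element of S on the family [zs_decr], which is a basis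
   by [zs_coord_decr] below. *)
Definition zs_coord (s : zeta_series) : words R := projT1 (cid (zs_span s)).

Lemma zs_coordK s : lin_ext zs_decr (zs_coord s) = s.
Proof. by rewrite /zs_coord; case: cid. Qed.

Lemma zs_coord_lin_ext x : zs_coord (lin_ext zs_decr x) = x.
Proof.
by apply/malgP => w; rewrite -!zs_mass_lin_ext zs_coordK.
Qed.

Lemma zs_coord_decr w : zs_coord (zs_decr w) = << w >>.
Proof. by rewrite -[RHS]zs_coord_lin_ext lin_extU. Qed.

(* Qsh(k, l), with 0-based indices. *)
Definition is_qsh (k l n : nat) (sigma : {ffun 'I_(k + l) -> 'I_n}) : bool :=
  [&& [forall j, exists i, sigma i == j],
      [forall i : 'I_(k + l), forall j : 'I_(k + l),
         (i < j < k)%N ==> (sigma i < sigma j)%N]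
    & [forall i : 'I_(k + l), forall j : 'I_(k + l),
         (k <= i < j)%N ==> (sigma i < sigma j)%N]].

(* The word whose j-th letter is the sum of the letters of u ++ v with positions
   in the fibre of j. *)
Definition contract (u v : word) (n : nat)
    (sigma : {ffun 'I_(size u + size v) -> 'I_n}) : word :=
  [seq pnat_sum [seq nth pnat1 (u ++ v) (val i) |
                  i <- enum 'I_(size u + size v) & sigma i == j]
     | j <- enum 'I_n].

(* The sum over the sigma whose fibre over the least element is given by P. *)
Definition qsh_sum (P : pred nat) (u v : word) : zeta_series :=
  \sum_(n < (size u + size v).+1)
    \sum_(sigma : {ffun 'I_(size u + size v) -> 'I_n} |
            is_qsh sigma && [forall i, (val (sigma i) == 0%N) == P (val i)])
      zs_decr (contract sigma).

Definition sprec (u v : word) : zeta_series :=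
  match u, v with
  | [::], _ => 0
  | _, [::] => zs_decr u
  | _, _ => qsh_sum (pred1 0%N) u v
  end.

Definition ssucc (u v : word) : zeta_series :=
  match u, v with
  | _, [::] => 0
  | [::], _ => zs_decr v
  | _, _ => qsh_sum (pred1 (size u)) u v
  end.

Definition sdot (u v : word) : zeta_series :=
  match u, v with
  | [::], _ | _, [::] => 0
  | _, _ => qsh_sum (pred2 0%N (size u)) u v
  end.

Definition sstar (u v : word) : zeta_series :=
  match u, v with
  | [::], [::] => zs_decr [::]
  | _, _ => sprec u v + sdot u v + ssucc u v
  end.

Definition zs_op (op : word -> word -> zeta_series) (s t : zeta_series) :
    zeta_series :=
  bilin_ext op (zs_coord s) (zs_coord t).

Lemma zs_op_decr op u v : zs_op op (zs_decr u) (zs_decr v) = op u v.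
Proof. by rewrite /zs_op !zs_coord_decr bilin_extU. Qed.

Definition series_tridend : augTridendData R := {|
  at_space := zeta_series;
  at_one := zs_decr [::];
  at_aug := span_of [set w | w <> [::]] zs_decr;
  at_prec := zs_op sprec;
  at_dot := zs_op sdot;
  at_succ := zs_op ssucc;
  at_star := zs_op sstar
|}.

Definition zetaFS : words R -> zeta_series := lin_ext zs_decr.

End ZetaSeries.

(* Main.v *)
(** Both products are quasi-shuffles governed by the same recursion. Write
    [a.x] for the linear extension of prepending the letter [a]. On words,
    [a.x < y = a.(x * y)], [x > b.y = b.(x * y)] and
    [a.x . b.y = (a+b).(x * y)]; these rules reduce all tridendriform axioms to
    the associativity of [*], which follows by induction on the lengths.
    On series, removing the fibre over the least value from a quasi-shuffle
    [sigma] leaves a quasi-shuffle of shorter words, and every shorter one arises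
    exactly once; so the sums over [Qsh(k, l)] with prescribed first fibre obey
    the same rules and are the images under [zetaFS] of the products of words. *)
From HB Require Import structures.
From mathcomp Require Import all_boot all_order all_algebra.
From mathcomp Require Import finmap boolp classical_sets reals.
From mathcomp Require Import monalg zify.
Require Import Defs.

Set Implicit Arguments.
Unset Strict Implicit.
Unset Printing Implicit Defensive.

Import GRing.Theory.

Local Open Scope ring_scope.

(** * Linear extensions and spans *)

Section Extension.
Context (R : comNzRingType) (K : choiceType) (V W : lmodType R).

Lemma linear_lin_ext (f : V -> W) (g : K -> V) (x : {malg R[K]}) :
  linear f -> f (lin_ext g x) = lin_ext (fun k => f (g k)) x.
Proof.
move=> lf.
pose F : {linear V -> W} := HB.pack f (GRing.isLinear.Build R V W *:%R f lf).
rewrite -[f]/(F : V -> W) [LHS]linear_sum; apply: eq_bigr => k _.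
exact: linearZ.
Qed.

(** The tool by which identities between linear maps are reduced to words. *)
Lemma eq_on_span (P : set K) (e : K -> V) (f g : V -> W) :
  linear f -> linear g -> (forall k, P k -> f (e k) = g (e k)) ->
  forall x, span_of P e x -> f x = g x.
Proof.
move=> lf lg fg _ [y Py ->].
rewrite [LHS](linear_lin_ext _ _ lf) [RHS](linear_lin_ext _ _ lg).
rewrite /lin_ext big_seq [RHS]big_seq; apply: eq_bigr => k yk.
by rewrite fg //; apply: Py.
Qed.

Lemma span_subspace (P : set K) (e : K -> V) : subspace (span_of P e).
Proof.
split=> [|a _ _ [x Px ->] [y Py ->]].
  by exists 0; rewrite ?linear0 // => k; rewrite msupp0 in_fset0.
exists (a *: x + y); last by rewrite linearP.
move=> k kxy; have : k \in (msupp (a *: x) `|` msupp y)%fset.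
  by apply: (fsubsetP (msuppD_le _ _)).
rewrite in_fsetU => /orP[/(fsubsetP (msuppZ_le _ _))|]; [exact: Px|exact: Py].
Qed.

Lemma span_gen (P : set K) (e : K -> V) k : P k -> span_of P e (e k).
Proof.
move=> Pk; exists << k >>; last by rewrite lin_extU.
by move=> l /(fsubsetP msuppU_le); rewrite in_fset1 => /eqP ->.
Qed.

Lemma subspace_span (P : set K) (e : K -> V) (A : set V) :
  subspace A -> (forall k, P k -> A (e k)) -> forall x, span_of P e x -> A x.
Proof.
move=> [A0 AD] Ae _ [y Py ->]; rewrite /lin_ext big_seq.
elim/big_rec: _ => // k x yk Ax; apply: AD => //; exact/Ae/Py.
Qed.

Lemma subspace_lin_preim (f : V -> W) (A : set W) :
  linear f -> subspace A -> subspace (fun x => A (f x)).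
Proof.
move=> lf [A0 AD].
pose F : {linear V -> W} := HB.pack f (GRing.isLinear.Build R V W *:%R f lf).
split=> [|a x y Ax Ay]; last by rewrite lf; apply: AD.
by rewrite -[f]/(F : V -> W) linear0.
Qed.

Lemma linear_compose (U : lmodType R) (f : V -> W) (g : U -> V) :
  linear f -> linear g -> linear (fun x => f (g x)).
Proof. by move=> lf lg a x y; rewrite lg lf. Qed.

Lemma linear_addf (f g : V -> W) :
  linear f -> linear g -> linear (fun x => f x + g x).
Proof. by move=> lf lg a x y; rewrite lf lg scalerDr addrACA. Qed.

End Extension.

Section BilinearExtension.
Context (R : comNzRingType) (K : choiceType) (V : lmodType R).

(** Linearity in the second argument moves a scalar past the coefficients of the first, which is
    where commutativity of [R] enters. *)
Lemma bilin_ext_bilinear (g : K -> K -> V) :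
  (forall y, linear ((bilin_ext g)^~ y)) /\ (forall x, linear (bilin_ext g x)).
Proof.
split=> [y|x a y z]; first exact: lin_ext_linear.
rewrite /bilin_ext {1 3 5}/lin_ext scaler_sumr -big_split.
apply: eq_bigr => k _ /=; rewrite [X in _ *: X]lin_ext_linear.
by rewrite scalerDr !scalerA mulrC.
Qed.

Local Notation basis := (fun k : K => << k >> : {malg R[K]}).

Lemma lin_ext_basis (x : {malg R[K]}) : lin_ext basis x = x.
Proof.
rewrite [RHS]monalgE; apply: eq_bigr => k _.
by apply/malgP => l; rewrite mcoeffZ !mcoeffU mulr_natr.
Qed.

Lemma span_malgP (P : set K) (x : {malg R[K]}) :
  span_of P basis x <-> forall k, k \in msupp x -> P k.
Proof.
split=> [[y Py ->] k|xP]; first by rewrite lin_ext_basis; apply: Py.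
by exists x; rewrite ?lin_ext_basis.
Qed.

End BilinearExtension.

(** * Tridendriform axioms from the quasi-shuffle recursion *)

Section BilinearOp.
Context (R : nzRingType) (V : lmodType R) (op : V -> V -> V).
Hypothesis op_bilinear : bilinear_op op.

Lemma bilinPl k x y z : op (k *: x + y) z = k *: op x z + op y z.
Proof. exact: op_bilinear.1. Qed.

Lemma bilinPr k x y z : op z (k *: x + y) = k *: op z x + op z y.
Proof. exact: op_bilinear.2. Qed.

Lemma bilinDl x y z : op (x + y) z = op x z + op y z.
Proof. by rewrite -{1}(scale1r x) bilinPl scale1r. Qed.

Lemma bilinDr x y z : op z (x + y) = op z x + op z y.
Proof. by rewrite -{1}(scale1r x) bilinPr scale1r. Qed.

End BilinearOp.

(* Stated over an abstract module so that it applies to both words and series. *)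
Section QuasiShuffleAxioms.
Context (R : comNzRingType) (V : lmodType R) (e : word -> V).
Context (cons : pnat -> V -> V) (star prec dot succ : V -> V -> V).
Hypothesis e_span : forall x, span_of setT e x.
Hypothesis cons_linear : forall a, linear (cons a).
Hypotheses (star_bilinear : bilinear_op star) (prec_bilinear : bilinear_op prec)
  (dot_bilinear : bilinear_op dot) (succ_bilinear : bilinear_op succ).
Hypothesis consE : forall a w, cons a (e w) = e (a :: w).
Hypothesis starE : forall u v, u <> [::] \/ v <> [::] ->
  star (e u) (e v) = prec (e u) (e v) + dot (e u) (e v) + succ (e u) (e v).
Hypothesis one_starE : forall u, star (e [::]) (e u) = e u.
Hypothesis star_oneE : forall u, star (e u) (e [::]) = e u.
Hypothesis precE : forall a u v,
  prec (cons a (e u)) (e v) = cons a (star (e u) (e v)).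
Hypothesis succE : forall b u v,
  succ (e u) (cons b (e v)) = cons b (star (e u) (e v)).
Hypothesis dotE : forall a b u v,
  dot (cons a (e u)) (cons b (e v)) = cons (pnat_add a b) (star (e u) (e v)).

Implicit Types (x y z : V) (u v w : word) (a b c : pnat).
Local Notation aug := (span_of [set w : word | w <> [::]] e).

Let starP := (bilinPl star_bilinear, bilinPr star_bilinear).
Let precP := (bilinPl prec_bilinear, bilinPr prec_bilinear).
Let dotP := (bilinPl dot_bilinear, bilinPr dot_bilinear).
Let succP := (bilinPl succ_bilinear, bilinPr succ_bilinear).
Let consP a k x y : cons a (k *: x + y) = k *: cons a x + cons a y.
Proof. exact: cons_linear. Qed.
Let linE := (starP, precP, dotP, succP, consP).

Lemma cons_add a x y : cons a (x + y) = cons a x + cons a y.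
Proof. by rewrite -{1}(scale1r x) consP scale1r. Qed.

Lemma pnat_addA : associative pnat_add.
Proof. by move=> a b c; apply: val_inj; rewrite /= addnA. Qed.

Lemma words_eq (f g : V -> V) :
  linear f -> linear g -> (forall w, f (e w) = g (e w)) -> f =1 g.
Proof.
by move=> lf lg fg x; apply: (eq_on_span lf lg _ (e_span x)) => w _; apply: fg.
Qed.

(** The generators of [aug] are nonempty words, hence values of [cons], so the recursion rules reach
    all of [aug]. *)
Lemma aug_eq (f g : V -> V) :
  linear f -> linear g -> (forall a x, f (cons a x) = g (cons a x)) ->
  forall x, aug x -> f x = g x.
Proof.
move=> lf lg fg; apply: (eq_on_span lf lg) => -[//|a w] _.
by rewrite -consE fg.
Qed.

Lemma aug_cons a x : aug (cons a x).
Proof.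
have h : subspace (fun x => aug (cons a x)).
  by apply: subspace_lin_preim; [exact: cons_linear|exact: span_subspace].
by apply: (subspace_span h _ (e_span x)) => u _; rewrite consE; apply: span_gen.
Qed.

Lemma prec_cons a x y : prec (cons a x) y = cons a (star x y).
Proof.
move: x; apply: words_eq => [k x z|k x z|u]; rewrite ?linE //.
move: y; apply: words_eq => [k x z|k x z|v]; rewrite ?linE //.
Qed.

Lemma succ_cons x b y : succ x (cons b y) = cons b (star x y).
Proof.
move: x; apply: words_eq => [k x z|k x z|u]; rewrite ?linE //.
move: y; apply: words_eq => [k x z|k x z|v]; rewrite ?linE //.
Qed.

Lemma dot_cons a x b y :
  dot (cons a x) (cons b y) = cons (pnat_add a b) (star x y).
Proof.
move: x; apply: words_eq => [k x z|k x z|u]; rewrite ?linE //.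
move: y; apply: words_eq => [k x z|k x z|v]; rewrite ?linE //.
Qed.

Lemma one_starV x : star (e [::]) x = x.
Proof. by move: x; apply: words_eq => [k x z|//|u]; rewrite ?linE. Qed.

Lemma star_oneV x : star x (e [::]) = x.
Proof. by move: x; apply: words_eq => [k x z|//|u]; rewrite ?linE. Qed.

(** [starE] asks for one nonempty word, and [x] in [aug] supplies it whatever [y] is. *)
Lemma star_sum_aug x y : aug x -> star x y = prec x y + dot x y + succ x y.
Proof.
move: x; apply: eq_on_span => [||u /= u0]; first exact: star_bilinear.1.
  exact: (linear_addf (linear_addf (prec_bilinear.1 _) (dot_bilinear.1 _))
    (succ_bilinear.1 _)).
move: y; apply: words_eq => [||v]; first exact: star_bilinear.2.
  exact: (linear_addf (linear_addf (prec_bilinear.2 _) (dot_bilinear.2 _))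
    (succ_bilinear.2 _)).
by apply: starE; left.
Qed.

Lemma star_cons a x b y : star (cons a x) (cons b y) =
  cons a (star x (cons b y)) + cons b (star (cons a x) y)
  + cons (pnat_add a b) (star x y).
Proof.
rewrite (star_sum_aug _ (aug_cons _ _)) prec_cons dot_cons succ_cons.
exact: addrAC.
Qed.

(** Multilinearity reduces the claim to three words, treated by nested inductions. For nonempty
    words both bracketings expand into the same seven head letters, followed by the two bracketings
    of a shorter triple. *)
Lemma starA x y z : star (star x y) z = star x (star y z).
Proof.
move: x; apply: words_eq => [k x x'|k x x'|u]; rewrite ?linE //.
move: y; apply: words_eq => [k y y'|k y y'|v]; rewrite ?linE //.
move: z; apply: words_eq => [k z z'|k z z'|w]; rewrite ?linE //.
elim: u v w => [|a u IHu] v w; first by rewrite !one_starV.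
elim: v w => [|b v IHv] w; first by rewrite one_starV star_oneV.
elim: w => [|c w IHw]; first by rewrite !star_oneV.
(* Seven instances: one for each nonempty set of words that lose their first letter. *)
move: (IHv (c :: w)) (IHv w) IHw (IHu (b :: v) (c :: w)) (IHu (b :: v) w)
  (IHu v (c :: w)) (IHu v w) => {IHu IHv}.
rewrite -!consE.
have starD := (bilinDl star_bilinear, bilinDr star_bilinear).
move: (e u) (e v) (e w) => {u v w} x y z.
set A := cons a x; set B := cons b y; set C := cons c z => h1 h2 h3 h4 h5 h6 h7.
transitivity (cons a (star (star x B) C) + cons b (star (star A y) C) +
  cons c (star (star A B) z) + cons (pnat_add a b) (star (star x y) C)
  + cons (pnat_add a c) (star (star x B) z)
  + cons (pnat_add b c) (star (star A y) z)
  + cons (pnat_add (pnat_add a b) c) (star (star x y) z)).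
  rewrite [star A B]star_cons -/A -/B !starD !star_cons -/C !cons_add.
  (* Terms 2, 5 and 8 have head [c]; they form the expansion of [cons c (star (star A B) z)]. *)
  by rewrite [LHS](AC (3*3*3) (1*4*(2*5*8)*7*3*6*9)).
rewrite h1 h2 h3 h4 h5 h6 h7.
rewrite [star B C]star_cons -/B -/C !starD !star_cons -/A !cons_add pnat_addA.
(* Symmetrically, terms 1, 4 and 7 have head [a] and form [cons a (star x (star B C))]. *)
by rewrite [RHS](AC (3*3*3) ((1*4*7)*2*5*3*6*8*9)).
Qed.

(** Once the relevant arguments are written with heads, both sides of each axiom have the same head
    letter, followed by the two bracketings of one triple product; [starA] identifies these. *)
Lemma quasi_shuffle_tridendriform : tridendriform_on aug prec dot succ.
Proof.
have aug_lin (f : V -> V) : linear f ->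
    (forall a x, aug (f (cons a x))) -> forall x, aug x -> aug (f x).
  move=> lf fa.
  have sA := subspace_lin_preim lf (span_subspace [set w : word | w <> [::]] e).
  apply: (subspace_span sA).
  by move=> [//|a u] _; rewrite -consE; exact: (fa a (e u)).
split=> [x y + _|x y + Ay|x y _|x y z + Ay Az|x y z _ + _|x y z Ax _|x y z _ + Az
  |x y z + _ Az|x y z + Ay _|x y z + Ay Az].
- apply: (aug_lin (prec^~ y)) => [k x' x''|a x']; rewrite ?linE //.
  by rewrite prec_cons; apply: aug_cons.
- apply: (aug_lin (dot^~ y)) => [k x' x''|a x']; rewrite ?linE //.
  move: y Ay; apply: (aug_lin (dot _)) => [k y' y''|b y']; rewrite ?linE //.
  by rewrite dot_cons; apply: aug_cons.
- apply: (aug_lin (succ x)) => [k y' y''|b y']; rewrite ?linE //.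
  by rewrite succ_cons; apply: aug_cons.
- rewrite -star_sum_aug //.
  move: x; apply: aug_eq => [k ? ?|k ? ?|a x]; rewrite ?linE //.
  by rewrite !prec_cons starA.
- move: y; apply: aug_eq => [k ? ?|k ? ?|b y]; rewrite ?linE //.
  by rewrite !(prec_cons, succ_cons) starA.
- rewrite -star_sum_aug //.
  move: z; apply: aug_eq => [k ? ?|k ? ?|c z]; rewrite ?linE //.
  by rewrite !succ_cons starA.
- move: y; apply: aug_eq => [k ? ?|k ? ?|b y]; rewrite ?linE //.
  move: z Az; apply: aug_eq => [k ? ?|k ? ?|c z]; rewrite ?linE //.
  by rewrite !(succ_cons, dot_cons) starA.
- move: x; apply: aug_eq => [k ? ?|k ? ?|a x]; rewrite ?linE //.
  move: z Az; apply: aug_eq => [k ? ?|k ? ?|c z]; rewrite ?linE //.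
  by rewrite !(prec_cons, succ_cons, dot_cons) starA.
- move: x; apply: aug_eq => [k ? ?|k ? ?|a x]; rewrite ?linE //.
  move: y Ay; apply: aug_eq => [k ? ?|k ? ?|b y]; rewrite ?linE //.
  by rewrite !(prec_cons, dot_cons) starA.
- move: x; apply: aug_eq => [k ? ?|k ? ?|a x]; rewrite ?linE //.
  move: y Ay; apply: aug_eq => [k ? ?|k ? ?|b y]; rewrite ?linE //.
  move: z Az; apply: aug_eq => [k ? ?|k ? ?|c z]; rewrite ?linE //.
  by rewrite !dot_cons starA pnat_addA.
Qed.

Hypothesis one_notin_aug : ~ aug (e [::]).
Hypothesis one_precE : forall u, u <> [::] -> prec (e [::]) (e u) = 0.
Hypothesis one_dotE : forall u, u <> [::] -> dot (e [::]) (e u) = 0.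
Hypothesis dot_oneE : forall u, u <> [::] -> dot (e u) (e [::]) = 0.
Hypothesis succ_oneE : forall u, u <> [::] -> succ (e u) (e [::]) = 0.

Lemma quasi_shuffle_aug_tridendriform : aug_tridendriform
  (@AugTridendData R V (e [::]) aug prec dot succ star).
Proof.
have cst0 : linear (fun _ : V => 0 : V) by move=> k x y; rewrite scaler0 addr0.
have idl : linear (fun x : V => x) by [].
split=> //=.
- exact: span_subspace.
(* The decomposable elements form a subspace, so words are enough: the empty word lies on the unit
   line, the others in [aug]. *)
- have sA : subspace (fun x => exists y (k : R), aug y /\ x = y + k *: e [::]).
    split=> [|k x y [x' [l [Ax ->]]] [y' [m [Ay ->]]]].
      exists 0, 0; rewrite scale0r addr0; split=> //.
      exact: (span_subspace _ _).1.
    exists (k *: x' + y'), (k * l + m).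
    rewrite scalerDr scalerDl scalerA addrACA; split=> //.
    exact: (span_subspace _ _).2.
  move=> x; apply: (subspace_span sA _ (e_span x)) => w _.
  case: w => [|b w].
    exists 0, 1; rewrite scale1r add0r; split=> //.
    exact: (span_subspace _ _).1.
  by exists (e (b :: w)), 0; rewrite scale0r addr0; split=> //; apply: span_gen.
- exact: quasi_shuffle_tridendriform.
- by move=> x y Ax _; apply: star_sum_aug.
- by apply: eq_on_span => //; apply: prec_bilinear.2.
(* Since [a.x < 1 = a.(x * 1)], this law reduces to the unit law of [star]. *)
- apply: aug_eq => [||a x]; [exact: prec_bilinear.1|exact: idl|].
  by rewrite prec_cons star_oneV.
- by apply: eq_on_span => //; apply: dot_bilinear.2.
- by apply: eq_on_span => //; apply: dot_bilinear.1.
- apply: aug_eq => [||a x]; [exact: succ_bilinear.2|exact: idl|].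
  by rewrite succ_cons one_starV.
- by apply: eq_on_span => //; apply: succ_bilinear.1.
- exact: one_starV.
- exact: star_oneV.
Qed.

End QuasiShuffleAxioms.

(** * The augmented tridendriform algebra of words *)

Section WordsTridendriform.
Context (R : comNzRingType).
Implicit Types (u v w : word) (a b : pnat).

Lemma qshuffle0l v : qshuffle R [::] v = << v >>. Proof. by case: v. Qed.

Lemma qshuffle0r u : qshuffle R u [::] = << u >>. Proof. by case: u. Qed.

(** For empty [v], the value [<< a :: u >>] set by the definition agrees with the recursion because
    the empty word is a unit for [qshuffle]. *)
Lemma wprecE a u v : wprec R (a :: u) v = wcons a (qshuffle R u v).
Proof. by case: v => [|b v] //; rewrite qshuffle0r [RHS]lin_extU. Qed.

Lemma wsuccE b u v : wsucc R u (b :: v) = wcons b (qshuffle R u v).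
Proof. by case: u => [|a u] //; rewrite qshuffle0l [RHS]lin_extU. Qed.

Lemma wdotE a u b v :
  wdot R (a :: u) (b :: v) = wcons (pnat_add a b) (qshuffle R u v).
Proof. by []. Qed.

(** Two empty words are excluded: their three partial products vanish, while [qshuffle] gives the
    empty word. *)
Lemma qshuffle_sum u v : u <> [::] \/ v <> [::] ->
  qshuffle R u v = wprec R u v + wdot R u v + wsucc R u v.
Proof.
case: u v => [|a u] [|b v] uv.
- by case: uv.
- by rewrite [X in X + _]addr0 add0r.
- by rewrite !addr0.
- exact: addrAC.
Qed.

Lemma words_aug_tridendriform : aug_tridendriform (words_tridend R).
Proof.
apply: (@quasi_shuffle_aug_tridendriform R (words R) _ (@wcons R)).
- by move=> x; apply/span_malgP.
- by move=> a; exact: lin_ext_linear.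
- exact: bilin_ext_bilinear.
- exact: bilin_ext_bilinear.
- exact: bilin_ext_bilinear.
- exact: bilin_ext_bilinear.
- by move=> a w; exact: lin_extU.
- move=> u v uv; rewrite [LHS]bilin_extU (qshuffle_sum uv).
  by congr (_ + _ + _); symmetry; exact: bilin_extU.
- by move=> u; rewrite [LHS]bilin_extU qshuffle0l.
- by move=> u; rewrite [LHS]bilin_extU qshuffle0r.
- move=> a u v; rewrite [wcons a << u >>]lin_extU [LHS]bilin_extU wprecE.
  by congr wcons; symmetry; exact: bilin_extU.
- move=> b u v; rewrite [wcons b << v >>]lin_extU [LHS]bilin_extU wsuccE.
  by congr wcons; symmetry; exact: bilin_extU.
- move=> a b u v; rewrite [wcons a << u >>]lin_extU [wcons b << v >>]lin_extU.
  rewrite [LHS]bilin_extU wdotE.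
  by congr wcons; symmetry; exact: bilin_extU.
- by move/span_malgP => /(_ [::]); apply; rewrite // -mcoeff_neq0 mcoeffUU oner_eq0.
- by move=> u _; rewrite [LHS]bilin_extU.
- by move=> u _; rewrite [LHS]bilin_extU.
- by move=> u _; rewrite [LHS]bilin_extU; case: u.
- by move=> u _; rewrite [LHS]bilin_extU; case: u.
Qed.

End WordsTridendriform.

(** * Removing the first fibre of a quasi-shuffle *)

Section FirstFibre.

Lemma is_qshP k l n (s : {ffun 'I_(k + l) -> 'I_n}) :
  reflect [/\ forall j, exists i, s i = j,
              forall i j : 'I_(k + l), (i < j < k)%N -> (s i < s j)%N
            & forall i j : 'I_(k + l), (k <= i < j)%N -> (s i < s j)%N]
          (@is_qsh k l n s).
Proof.
apply: (iffP and3P) => -[h1 h2 h3]; split.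
- by move=> j; have /existsP[i /eqP] := forallP h1 j; exists i.
- by move=> i j; move/forallP: h2 => /(_ i) /forallP/(_ j) /implyP.
- by move=> i j; move/forallP: h3 => /(_ i) /forallP/(_ j) /implyP.
- by apply/forallP => j; apply/existsP; have [i <-] := h1 j; exists i.
- by apply/'forall_forallP => i j; apply/implyP/h2.
- by apply/'forall_forallP => i j; apply/implyP/h3.
Qed.

Definition first_fibre (P : pred nat) m n (s : {ffun 'I_m -> 'I_n}) : bool :=
  [forall i, (val (s i) == 0%N) == P (val i)].

Context (u v u' v' : word) (a : pnat) (P : pred nat) (f g : nat -> nat).
Local Notation k := (size u).
Local Notation k' := (size u').
Local Notation m := (size u + size v)%N.
Local Notation m' := (size u' + size v')%N.

(* [f] enumerates increasingly the positions of [u ++ v] outside [P], with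
   inverse [g]. *)
Hypothesis f_lt : forall i, (i < m')%N -> (f i < m)%N.
Hypothesis f_notin : forall i, ~~ P (f i).
Hypothesis f_mono : {mono f : i j / (i < j)%N}.
Hypothesis fK : cancel f g.
Hypothesis g_lt : forall j, (j < m)%N -> ~~ P j -> (g j < m')%N.
Hypothesis gK : forall j, (j < m)%N -> ~~ P j -> f (g j) = j.
Hypothesis f_block : forall i, (f i < k)%N = (i < k')%N.
(** Positions in [P] are the first of their block, so giving them the least value respects
    monotonicity on each block. *)
Hypothesis P_min : forall i j, (i < j)%N -> P j -> (i < k <= j)%N.
Hypothesis P_mem : exists2 i, (i < m)%N & P i.
Hypothesis f_nth : forall i, (i < m')%N ->
  nth pnat1 (u ++ v) (f i) = nth pnat1 (u' ++ v') i.
Hypothesis P_letter :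
  pnat_sum [seq nth pnat1 (u ++ v) i | i <- iota 0 m & P i] = a.

Let fO (i : 'I_m') : 'I_m := Ordinal (f_lt (ltn_ord i)).

Let ordP (j : 'I_m) : P j \/ exists i, j = fO i.
Proof.
have [Pj|nPj] := boolP (P j); [by left|right].
exists (Ordinal (g_lt (ltn_ord j) nPj)).
by apply: val_inj; rewrite /= gK.
Qed.

Section Fixed.
Context (n : nat).
Implicit Types (s : {ffun 'I_m' -> 'I_n}).

(** Inverse to removing the fibre [P]: old values are shifted up by [lift ord0], which frees the
    value 0. The last [ord0] is a default that is never reached, since [g j] is in range outside
    [P]. *)
Definition add_fibre s : {ffun 'I_m -> 'I_n.+1} := [ffun j : 'I_m =>
  if P j then ord0 else if insub (g j) is Some i then lift ord0 (s i) else ord0].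

Lemma add_fibreP s j : P (val j) -> add_fibre s j = ord0.
Proof. by rewrite ffunE => ->. Qed.

Lemma add_fibreF s i : add_fibre s (fO i) = lift ord0 (s i).
Proof.
rewrite ffunE /= (negPf (f_notin _)) fK.
by rewrite [insub _](valK i).
Qed.

Lemma add_fibre_inj : injective add_fibre.
Proof.
move=> s t /ffunP st; apply/ffunP => i.
by have := st (fO i); rewrite !add_fibreF => /lift_inj.
Qed.

Lemma add_fibre_first s : first_fibre P (add_fibre s).
Proof.
apply/forallP => j; have [Pj|[i ->]] := ordP j.
  by rewrite add_fibreP // Pj.
by rewrite add_fibreF /= (negPf (f_notin _)).
Qed.

Lemma first_fibreP (t : {ffun 'I_m -> 'I_n.+1}) :
  first_fibre P t -> exists s, t = add_fibre s.
Proof.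
move/forallP => tP.
have /fin_all_exists[s sE] : forall i : 'I_m', exists x, t (fO i) = lift ord0 x.
  move=> i; case: (unliftP ord0 (t (fO i))) => [x ->|ti]; first by exists x.
  by have := tP (fO i); rewrite ti /= (negPf (f_notin _)).
exists (finfun s); apply/ffunP => j; have [Pj|[i ->]] := ordP j.
  by rewrite add_fibreP //; apply: val_inj; have /eqP := tP j; rewrite Pj => /eqP.
by rewrite add_fibreF ffunE.
Qed.

Lemma add_fibre_qsh s : is_qsh (add_fibre s) = is_qsh s.
Proof.
apply/is_qshP/is_qshP => -[sur mL mR]; split.
- move=> j; have [i] := sur (lift ord0 j).
  have [Pi|[i' ->]] := ordP i; first by rewrite add_fibreP.
  by rewrite add_fibreF => /lift_inj; exists i'.
- move=> i j ijk; have := mL (fO i) (fO j).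
  by rewrite !add_fibreF /= f_mono f_block => /(_ ijk); rewrite /bump /=; lia.
- move=> i j ijk; have := mR (fO i) (fO j).
  rewrite !add_fibreF /= f_mono leqNgt f_block -leqNgt => /(_ ijk).
  by rewrite /bump /=; lia.
- move=> j; case: (unliftP ord0 j) => [x|] ->.
    by have [i <-] := sur x; exists (fO i); rewrite add_fibreF.
  by case: P_mem => i im Pi; exists (Ordinal im); rewrite add_fibreP.
(* If [j] is in [P], then [P_min] puts [i] and [j] in different blocks; if only [i] is, its value 0
   is below every lifted value. *)
- move=> i j /andP[ij jk]; have [Pj|[j' ?]] := ordP j.
    by have := P_min ij Pj; lia.
  subst j; rewrite add_fibreF; have [Pi|[i' ?]] := ordP i.
    by rewrite add_fibreP.
  subst i; rewrite add_fibreF.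
  have h : (i' < j' < k')%N by rewrite -f_mono -f_block; apply/andP.
  by have := mL _ _ h; rewrite /= /bump /=; lia.
- move=> i j /andP[ki ij]; have [Pj|[j' ?]] := ordP j.
    by have := P_min ij Pj; lia.
  subst j; rewrite add_fibreF; have [Pi|[i' ?]] := ordP i.
    by rewrite add_fibreP.
  subst i; rewrite add_fibreF.
  have h : (k' <= i' < j')%N.
    by rewrite -f_mono leqNgt -f_block -leqNgt; apply/andP.
  by have := mR _ _ h; rewrite /= /bump /=; lia.
Qed.

Lemma sorted_enum_ord p : sorted (fun i j : 'I_p => (i < j)%N) (enum 'I_p).
Proof. by have := iota_ltn_sorted 0 p; rewrite -val_enum_ord sorted_map. Qed.

(** The fibre over 0 is [P], which yields [a]; the other fibres are the images under [f] of those of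
    [s] and carry the same letters by [f_nth]. *)
Lemma add_fibre_contract s :
  @contract u v n.+1 (add_fibre s) = a :: @contract u' v' n s.
Proof.
rewrite /contract enum_ordSl /=; congr cons.
  rewrite -P_letter; congr pnat_sum.
  rewrite -val_enum_ord filter_map -map_comp; congr map.
  apply: eq_filter => j /=; have [Pj|[i ->]] := ordP j.
    by rewrite add_fibreP // eqxx Pj.
  by rewrite add_fibreF /= (negPf (f_notin _)).
rewrite -map_comp; apply: eq_map => x /=; congr pnat_sum.
have -> : [seq i <- enum 'I_m | add_fibre s i == lift ord0 x] =
    [seq fO i | i <- enum 'I_m' & s i == x].
  apply: (@irr_sorted_eq _ (fun i j : 'I_m => (i < j)%N)).
  - by move=> ? ? ?; apply: ltn_trans.
  - by move=> ?; apply: ltnn.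
  - by apply: sorted_filter (sorted_enum_ord _) => ? ? ?; apply: ltn_trans.
  - rewrite sorted_map; have h : sorted (fun i j : 'I_m' => (i < j)%N)
        [seq i <- enum 'I_m' | s i == x].
      by apply: sorted_filter (sorted_enum_ord _) => ? ? ?; apply: ltn_trans.
    by apply: sub_sorted h => i j; rewrite /= f_mono.
  - move=> j; rewrite mem_filter mem_enum andbT.
    apply/eqP/mapP => [|[i]]; last first.
      by rewrite mem_filter => /andP[/eqP <- _] ->; rewrite add_fibreF.
    have [Pj|[i ->]] := ordP j; first by rewrite add_fibreP.
    rewrite add_fibreF => /lift_inj si; exists i => //.
    by rewrite mem_filter si eqxx mem_enum.
by rewrite -map_comp; apply: eq_map => i /=; rewrite f_nth.
Qed.

(** The sum is reindexed along [add_fibre], a bijection from the quasi-shuffles of the shorter words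
    onto those with first fibre [P]. *)
Lemma sum_first_fibre (V : nmodType) (G : word -> V) :
  \sum_(t : {ffun 'I_m -> 'I_n.+1} | is_qsh t && first_fibre P t) G (contract t)
  = \sum_(s : {ffun 'I_m' -> 'I_n} | is_qsh s) G (a :: contract s).
Proof.
transitivity (\sum_(t in add_fibre @: [set s | is_qsh s]) G (contract t)).
  apply: eq_bigl => t; apply/andP/imsetP => [[qt /first_fibreP[s ts]]|[s]].
    by exists s => //; rewrite inE -add_fibre_qsh -ts.
  by rewrite inE => qs ->; rewrite add_fibre_qsh add_fibre_first.
rewrite big_imset => [|s t _ _]; last exact: add_fibre_inj.
by under eq_bigl do rewrite inE; apply: eq_bigr => s _; rewrite add_fibre_contract.
Qed.

End Fixed.
End FirstFibre.

(** * The three possible first fibres *)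

Section ThreeFibres.
Context (V : nmodType) (G : word -> V) (n : nat) (a b : pnat) (u v : word).

Lemma sum_fibre_prec :
  \sum_(t : {ffun 'I_(size (a :: u) + size v) -> 'I_n.+1} |
      is_qsh t && first_fibre (pred1 0%N) t) G (contract t)
  = \sum_(s : {ffun 'I_(size u + size v) -> 'I_n} | is_qsh s) G (a :: contract s).
Proof.
apply: (@sum_first_fibre _ _ _ _ _ _ succn predn) => //=.
- by case.
- by case.
- by move=> i j ij /eqP; lia.
- by exists 0%N.
- rewrite (@eq_in_filter _ _ pred0) ?filter_pred0 // => i.
  by rewrite mem_iota; case: i.
Qed.

Lemma sum_fibre_succ :
  \sum_(t : {ffun 'I_(size u + size (b :: v)) -> 'I_n.+1} |
      is_qsh t && first_fibre (pred1 (size u)) t) G (contract t)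
  = \sum_(s : {ffun 'I_(size u + size v) -> 'I_n} | is_qsh s) G (b :: contract s).
Proof.
(* [bump (size u)] skips the position [size u] of the letter [b]. *)
apply: (@sum_first_fibre _ _ _ _ _ _ (bump (size u)) (unbump (size u))) => /=.
- by move=> i; rewrite /bump; lia.
- by move=> i; rewrite /bump; lia.
- by move=> i j; rewrite /bump; apply/idP/idP; lia.
- exact: bumpK.
- by move=> j; rewrite /unbump; lia.
- by move=> j _ /= jk; rewrite unbumpK.
- by move=> i; rewrite /bump; apply/idP/idP; lia.
- by move=> i j ij /eqP jk; lia.
- by exists (size u); rewrite /= ?eqxx; lia.
- move=> i im; rewrite !nth_cat /bump; have [ui|ui] := leqP (size u) i.
    by rewrite add1n ltnNge leqW // subSn.
  by rewrite add0n ui.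
- rewrite filter_pred1_uniq ?iota_uniq ?mem_iota //=; last by lia.
  by rewrite nth_cat ltnn subnn.
Qed.

Lemma sum_fibre_dot :
  \sum_(t : {ffun 'I_(size (a :: u) + size (b :: v)) -> 'I_n.+1} |
      is_qsh t && first_fibre (pred2 0%N (size (a :: u))) t) G (contract t)
  = \sum_(s : {ffun 'I_(size u + size v) -> 'I_n} | is_qsh s)
      G (pnat_add a b :: contract s).
Proof.
(* Two positions are skipped: [bump (size u)] jumps over that of [b], counted without [a], and the
   successor jumps over that of [a]. *)
apply: (@sum_first_fibre _ _ _ _ _ _ (fun i => (bump (size u) i).+1)
  (fun j => unbump (size u) j.-1)) => /=.
- by move=> i; rewrite /bump; lia.
- by move=> i; rewrite /bump; lia.
- by move=> i j; rewrite /bump; apply/idP/idP; lia.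
- exact: bumpK.
- by move=> j; rewrite /unbump; lia.
- by move=> j _ /= jk; rewrite /bump /unbump; lia.
- by move=> i; rewrite /bump; apply/idP/idP; lia.
- by move=> i j ij /=; lia.
- by exists 0%N.
- move=> i im; rewrite !nth_cat /bump; have [ui|ui] := leqP (size u) i.
    by rewrite add1n ltnNge leqW // subSn.
  by rewrite add0n ui.
- rewrite (@eq_in_filter _ _ (pred1 (size u).+1)); last first.
    by move=> i; rewrite mem_iota /=; lia.
  rewrite filter_pred1_uniq ?iota_uniq ?mem_iota //=; last by lia.
  by rewrite nth_cat ltnn subnn.
Qed.

End ThreeFibres.

(** * Recursion for sums over quasi-shuffles *)

Section SumOverQsh.

(** A quasi-shuffle increases strictly along each block, so the value 0 can occur only at the start
    of one. *)
Lemma qsh_first_pos k l n (t : {ffun 'I_(k + l) -> 'I_n}) i :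
  @is_qsh k l n t -> val (t i) = 0%N -> (val i == 0%N) || (val i == k).
Proof.
move=> /is_qshP[_ mL mR] ti0; have [ik|ki] := ltnP i k.
  have i00 : (0 < k + l)%N by apply: leq_ltn_trans (ltn_ord i).
  have [//|i_gt0] := posnP i.
  by have := mL (Ordinal i00) i; rewrite /= i_gt0 ik => /(_ isT); rewrite ti0.
have [->|kNi] := eqVneq (val i) k; first by rewrite orbT.
have klt : (k < k + l)%N by apply: leq_ltn_trans ki (ltn_ord i).
have := mR (Ordinal klt) i; rewrite /= leqnn ltn_neqAle eq_sym kNi ki.
by move=> /(_ isT); rewrite ti0.
Qed.

Lemma qsh_first_ex k l n (t : {ffun 'I_(k + l) -> 'I_n.+1}) :
  @is_qsh k l n.+1 t -> exists i, val (t i) = 0%N.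
Proof.
by move=> /is_qshP[sur _ _]; have [i ti] := sur ord0; exists i; rewrite ti.
Qed.

(** The first fibre is determined by which of the two block starts take the value 0, and by
    surjectivity at least one does: three exclusive cases. *)
Lemma qsh_first_fibreE k l n (t : {ffun 'I_(k.+1 + l.+1) -> 'I_n.+1})
    (x0 := val (t (@lshift k.+1 l.+1 ord0)) == 0%N)
    (xk := val (t (@rshift k.+1 l.+1 ord0)) == 0%N) :
  @is_qsh k.+1 l.+1 n.+1 t ->
  [/\ x0 || xk, first_fibre (pred1 0%N) t = x0 && ~~ xk,
      first_fibre (pred1 k.+1) t = xk && ~~ x0
    & first_fibre (pred2 0%N k.+1) t = x0 && xk].
Proof.
move=> qt; have tE i : (val (t i) == 0%N) =
    ((val i == 0%N) && x0) || ((val i == k.+1) && xk).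
  have [i0|iN0] := eqVneq (val i) 0%N.
    have -> : i = lshift l.+1 ord0 by apply: val_inj.
    by rewrite -/x0 /= orbF.
  have [ik|iNk] := eqVneq (val i) k.+1.
    have -> : i = rshift k.+1 ord0 by apply: val_inj; rewrite /= addn0.
    by [].
  apply/negP => /eqP /(qsh_first_pos qt).
  by rewrite (negPf iN0) (negPf iNk).
have fE (P : pred nat) : (forall i, P i -> (i == 0%N) || (i == k.+1)) ->
    first_fibre P t = (x0 == P 0%N) && (xk == P k.+1).
  move=> PE; apply/forallP/andP => [h|[/eqP h0 /eqP hk] i].
    have := h (rshift k.+1 ord0); have := h (lshift l.+1 ord0).
    by rewrite -/x0 -/xk /= addn0.
  rewrite tE h0 hk; have [->|iN0] := eqVneq (val i) 0%N; first by rewrite /= orbF.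
  have [->|iNk] /= := eqVneq (val i) k.+1; first by [].
  by apply/eqP/esym/negP => /PE; rewrite (negPf iN0) (negPf iNk).
have x0k : x0 || xk.
  have [i /eqP] := qsh_first_ex qt.
  by rewrite tE => /orP[]/andP[_ ->]; rewrite ?orbT.
split=> //; rewrite fE /= ?eqxx ?orbT ?eqb_id ?eqbF_neg //=.
- by move=> i ->.
- by rewrite andbC.
- by move=> i ->; rewrite orbT.
Qed.

(** [N] bounds the number of values. By surjectivity every [N] from the total length on gives the
    same sum; leaving it free lets it decrease in inductions. *)
Definition qsh_total (V : nmodType) (G : word -> V) N (u v : word) : V :=
  \sum_(n < N.+1) \sum_(t : {ffun 'I_(size u + size v) -> 'I_n} | is_qsh t)
    G (contract t).

Definition qsh_fibre (V : nmodType) (G : word -> V) N (P : pred nat)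
    (u v : word) : V :=
  \sum_(n < N.+1) \sum_(t : {ffun 'I_(size u + size v) -> 'I_n} |
    is_qsh t && first_fibre P t) G (contract t).

Lemma big_ffun_to_ord0 (V : nmodType) m (Q : pred {ffun 'I_m -> 'I_0})
    (F : {ffun 'I_m -> 'I_0} -> V) : (0 < m)%N -> \sum_(t | Q t) F t = 0.
Proof. by move=> m0; apply: big1 => t _; case: (t (Ordinal m0)). Qed.

Context (V : nmodType) (N : nat).
Implicit Types (G : word -> V) (u v : word) (a b : pnat).

Lemma qsh_fibre_prec G a u v :
  qsh_fibre G N.+1 (pred1 0%N) (a :: u) v = qsh_total (G \o cons a) N u v.
Proof.
rewrite /qsh_fibre big_ord_recl [X in X + _]big_ffun_to_ord0 // add0r.
by apply: eq_bigr => n _; apply: sum_fibre_prec.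
Qed.

Lemma qsh_fibre_succ G b u v :
  qsh_fibre G N.+1 (pred1 (size u)) u (b :: v) = qsh_total (G \o cons b) N u v.
Proof.
rewrite /qsh_fibre big_ord_recl [X in X + _]big_ffun_to_ord0 ?addnS // add0r.
by apply: eq_bigr => n _; apply: sum_fibre_succ.
Qed.

Lemma qsh_fibre_dot G a b u v :
  qsh_fibre G N.+1 (pred2 0%N (size (a :: u))) (a :: u) (b :: v)
  = qsh_total (G \o cons (pnat_add a b)) N u v.
Proof.
rewrite /qsh_fibre big_ord_recl [X in X + _]big_ffun_to_ord0 // add0r.
by apply: eq_bigr => n _; apply: sum_fibre_dot.
Qed.

Lemma qsh_total_nil G : qsh_total G N [::] [::] = G [::].
Proof.
rewrite /qsh_total big_ord_recl [X in _ + X]big1 ?addr0 => [|n _]; last first.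
  apply: big_pred0 => t; apply/negP => /is_qshP[/(_ ord0)[[]]].
  by [].
rewrite (big_pred1 [ffun x => x]) => [|t]; first by rewrite /contract enum_ord0.
rewrite /= [_ == _](_ : _ = true); last by apply/eqP/ffunP => -[].
by apply/is_qshP; split=> [[]|[]|[]].
Qed.

(** With an empty first word only position 0 can take the value 0, so the fibre condition in
    [qsh_fibre_succ] holds for every quasi-shuffle. *)
Lemma qsh_total_nil_cons G b v :
  qsh_total G N.+1 [::] (b :: v) = qsh_total (G \o cons b) N [::] v.
Proof.
rewrite -qsh_fibre_succ /qsh_total /qsh_fibre big_ord_recl [RHS]big_ord_recl.
rewrite !big_ffun_to_ord0 //; congr (_ + _); apply: eq_bigr => n _.
apply: eq_bigl => t; symmetry; apply: andb_idr => qt; apply/forallP => i.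
have h j : val (t j) = 0%N -> val j = 0%N.
  by move=> /(qsh_first_pos qt); rewrite orbb => /eqP.
have [j tj] := qsh_first_ex qt; apply/eqP; apply/eqP/eqP => [|/= i0]; first by exact: h.
by rewrite (_ : i = j) //; apply: val_inj; rewrite /= i0 (h _ tj).
Qed.

Lemma qsh_total_cons_nil G a u :
  qsh_total G N.+1 (a :: u) [::] = qsh_total (G \o cons a) N u [::].
Proof.
rewrite -qsh_fibre_prec /qsh_total /qsh_fibre big_ord_recl [RHS]big_ord_recl.
rewrite !big_ffun_to_ord0 //; congr (_ + _); apply: eq_bigr => n _.
apply: eq_bigl => t; symmetry; apply: andb_idr => qt; apply/forallP => i.
have h j : val (t j) = 0%N -> val j = 0%N.
  move=> /(qsh_first_pos qt) /orP[/eqP //|/eqP /= jE].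
  by have := ltn_ord j; rewrite jE /= addn0 ltnn.
have [j tj] := qsh_first_ex qt; apply/eqP; apply/eqP/eqP => [|/= i0]; first by exact: h.
by rewrite (_ : i = j) //; apply: val_inj; rewrite /= i0 (h _ tj).
Qed.

Lemma qsh_total_cons_cons G a b u v :
  let u1 := a :: u in let v1 := b :: v in
  qsh_total G N.+1 u1 v1 = qsh_fibre G N.+1 (pred1 0%N) u1 v1
    + qsh_fibre G N.+1 (pred1 (size u1)) u1 v1
    + qsh_fibre G N.+1 (pred2 0%N (size u1)) u1 v1.
Proof.
move=> u1 v1; rewrite /qsh_total /qsh_fibre -!big_split /=.
apply: eq_bigr => -[[|n] ltn] _; first by rewrite !big_ffun_to_ord0 // !addr0.
rewrite /=.
pose x0 (t : {ffun 'I_(size u1 + size v1) -> 'I_n.+1}) :=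
  val (t (@lshift (size u).+1 (size v).+1 ord0)) == 0%N.
pose xk (t : {ffun 'I_(size u1 + size v1) -> 'I_n.+1}) :=
  val (t (@rshift (size u).+1 (size v).+1 ord0)) == 0%N.
(* The classes are: both starts at 0, only the first, and the first not at 0. Surjectivity turns the
   last into only the second. *)
rewrite (bigID x0) (bigID xk) /= -addrA [LHS]addrC.
congr (_ + _ + _); apply: eq_bigl => t; have [qt|//] := boolP (is_qsh t);
  have [xt e1 e2 e3] := qsh_first_fibreE qt; rewrite /= ?e1 ?e2 ?e3 //.
by move: xt; rewrite -/(x0 t) -/(xk t); case: (x0 t); case: (xk t).
Qed.

End SumOverQsh.

(** * The algebra of formal series and the morphism *)

Section SeriesTridendriform.
Context (R : realType).
Implicit Types (u v w : word) (a b : pnat).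

Lemma lin_ext_wcons (V : lmodType R) (G : word -> V) a (x : words R) :
  lin_ext G (wcons a x) = lin_ext (G \o cons a) x.
Proof.
have lG H : linear (lin_ext H : words R -> V) by exact: lin_ext_linear.
have lc := linear_compose (lG G) (@lin_ext_linear R word (words R) _).
have xT : span_of setT (fun w : word => << w >> : words R) x by apply/span_malgP.
apply: (eq_on_span (lc _) (lG _) _ xT) => w _.
by rewrite [X in lin_ext _ X]lin_extU !lin_extU.
Qed.

Lemma lin_extD (V : lmodType R) (G : word -> V) (x y : words R) :
  lin_ext G (x + y) = lin_ext G x + lin_ext G y.
Proof. exact: linearD. Qed.

Lemma qshuffle_cons a b u v : qshuffle R (a :: u) (b :: v) =
  wcons a (qshuffle R u (b :: v)) + wcons b (qshuffle R (a :: u) v)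
  + wcons (pnat_add a b) (qshuffle R u v).
Proof. by []. Qed.

(** The bridge between the two descriptions of the product: both obey the same recursion. The
    induction runs over all [G], because removing a head letter [a] replaces [G] by
    [G \o cons a]. *)
Lemma qsh_total_qshuffle (V : lmodType R) (G : word -> V) N u v :
  (size u + size v <= N)%N -> qsh_total G N u v = lin_ext G (qshuffle R u v).
Proof.
elim: N G u v => [|N IH] G u v uvN.
  case: u v uvN => [|? ?] [|? ?] // _.
  by rewrite qsh_total_nil qshuffle0l lin_extU.
case: u v uvN => [|a u] [|b v] uvN.
- by rewrite qsh_total_nil qshuffle0l lin_extU.
- by rewrite qsh_total_nil_cons IH // !qshuffle0l !lin_extU.
- rewrite qsh_total_cons_nil IH; last by rewrite /= addSn in uvN.
  by rewrite !qshuffle0r !lin_extU.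
rewrite qsh_total_cons_cons qsh_fibre_prec qsh_fibre_succ qsh_fibre_dot.
rewrite !IH; try by move: uvN; rewrite /=; lia.
rewrite qshuffle_cons lin_extD [X in _ = X + _]lin_extD.
by congr (_ + _ + _); symmetry; exact: lin_ext_wcons.
Qed.

Lemma sprecE u v : sprec R u v = zetaFS (wprec R u v).
Proof.
case: u v => [|a u] [|b v]; rewrite /zetaFS ?[lin_ext _ 0]linear0 //.
  by rewrite [RHS]lin_extU.
rewrite wprecE [RHS]lin_ext_wcons.
(* This [N] is one less than the total length of the two words, so that [N.+1] matches the bound in
   [qsh_sum]. *)
rewrite -(@qsh_total_qshuffle _ _ (size u + size (b :: v))) //.
by rewrite -qsh_fibre_prec.
Qed.

Lemma ssuccE u v : ssucc R u v = zetaFS (wsucc R u v).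
Proof.
case: u v => [|a u] [|b v]; rewrite /zetaFS ?[lin_ext _ 0]linear0 //.
  by rewrite [RHS]lin_extU.
rewrite wsuccE [RHS]lin_ext_wcons.
rewrite -(@qsh_total_qshuffle _ _ (size (a :: u) + size v)) //.
by rewrite -qsh_fibre_succ /= -addnS.
Qed.

Lemma sdotE u v : sdot R u v = zetaFS (wdot R u v).
Proof.
case: u v => [|a u] [|b v]; rewrite /zetaFS ?[lin_ext _ 0]linear0 //.
rewrite wdotE [RHS]lin_ext_wcons.
(* Two letters but only one value are removed, so [N] exceeds the total length of the shortened
   words by one. *)
rewrite -(@qsh_total_qshuffle _ _ (size u + size (b :: v))).
  by rewrite -qsh_fibre_dot.
by rewrite leq_add2l leqnSn.
Qed.

Lemma zetaFS_linear : linear (@zetaFS R). Proof. exact: lin_ext_linear. Qed.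

Lemma zetaFSU w : zetaFS << w >> = zs_decr R w. Proof. exact: lin_extU. Qed.

Lemma sstar_sum u v : u <> [::] \/ v <> [::] ->
  sstar R u v = sprec R u v + sdot R u v + ssucc R u v.
Proof. by case: u v => [|? ?] [|? ?] // []. Qed.

Lemma sstarE u v : sstar R u v = zetaFS (qshuffle R u v).
Proof.
case: u v => [|a u] [|b v]; first by rewrite qshuffle0l zetaFSU.
all: rewrite sstar_sum ?(qshuffle_sum R); try by [left|right].
all: rewrite sprecE sdotE ssuccE /zetaFS lin_extD.
all: by rewrite [X in _ = X + _]lin_extD.
Qed.

(** [zs_coord] picks preimages by choice, but it is the inverse of the linear map [zetaFS]. *)
Lemma zs_coord_linear : linear (@zs_coord R).
Proof.
move=> k s t; rewrite -{1}(zs_coordK s) -{1}(zs_coordK t).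
by rewrite -(@zetaFS_linear k) zs_coord_lin_ext.
Qed.

Lemma zs_op_bilinear op : bilinear_op (@zs_op R op).
Proof.
have [opl opr] := bilin_ext_bilinear op.
by split=> [t|s] k x y; rewrite /zs_op zs_coord_linear; [exact: opl|exact: opr].
Qed.

Lemma series_aug_tridendriform : aug_tridendriform (series_tridend R).
Proof.
pose cons a (s : zeta_series R) := zetaFS (wcons a (zs_coord s)).
have consE a w : cons a (zs_decr R w) = zs_decr R (a :: w).
  by rewrite /cons zs_coord_decr [wcons _ _]lin_extU zetaFSU.
apply: (@quasi_shuffle_aug_tridendriform R (zeta_series R) (@zs_decr R) cons).
- by move=> s; have [x ->] := zs_span s; exists x.
- move=> a k s t; rewrite /cons zs_coord_linear.
  by rewrite [wcons a _]lin_ext_linear zetaFS_linear.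
- exact: zs_op_bilinear.
- exact: zs_op_bilinear.
- exact: zs_op_bilinear.
- exact: zs_op_bilinear.
- exact: consE.
- by move=> u v uv; rewrite !zs_op_decr sstar_sum.
- by move=> u; rewrite zs_op_decr sstarE qshuffle0l zetaFSU.
- by move=> u; rewrite zs_op_decr sstarE qshuffle0r zetaFSU.
- move=> a u v; rewrite consE !zs_op_decr sprecE wprecE sstarE.
  by rewrite /cons zs_coord_lin_ext.
- move=> b u v; rewrite consE !zs_op_decr ssuccE wsuccE sstarE.
  by rewrite /cons zs_coord_lin_ext.
- move=> a b u v; rewrite !consE !zs_op_decr sdotE wdotE sstarE.
  by rewrite /cons zs_coord_lin_ext.
(* By uniqueness of coordinates, the unit in [aug] would force the empty word into the support of a
   combination of nonempty words. *)
- move=> [x xP /(congr1 (@zs_coord R))]; rewrite zs_coord_decr.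
  rewrite zs_coord_lin_ext => xE.
  by apply: (xP [::]); rewrite // -xE -mcoeff_neq0 mcoeffUU oner_eq0.
- by move=> u _; rewrite zs_op_decr.
- by move=> u _; rewrite zs_op_decr.
- by move=> u _; rewrite zs_op_decr; case: u.
- by move=> u _; rewrite zs_op_decr; case: u.
Qed.

(** The coordinates of [zetaFS x] are [x] itself, so agreement on pairs of words extends
    bilinearly. *)
Lemma zetaFS_bilin_ext (wop : word -> word -> words R)
    (sop : word -> word -> zeta_series R) :
  (forall u v, sop u v = zetaFS (wop u v)) -> forall x y,
  zetaFS (bilin_ext wop x y) = zs_op sop (zetaFS x) (zetaFS y).
Proof.
move=> opE x y; rewrite /zs_op !zs_coord_lin_ext.
rewrite [LHS](linear_lin_ext _ _ zetaFS_linear); apply: eq_bigr => u _.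
congr (_ *: _); rewrite [LHS](linear_lin_ext _ _ zetaFS_linear).
by apply: eq_bigr => v _; rewrite opE.
Qed.

End SeriesTridendriform.

Theorem proposition2p10 (R : realType) :
  [/\ aug_tridendriform (words_tridend R),
      aug_tridendriform (series_tridend R)
    & aug_tridend_morphism (T := words_tridend R) (U := series_tridend R)
        (@zetaFS R)].
Proof.
split; [exact: words_aug_tridendriform|exact: series_aug_tridendriform|split].
- exact: zetaFS_linear.
- exact: zetaFSU.
(* [zetaFS x] is the combination of series with the coefficients of [x], so [x] itself is the
   witness. *)
- by move=> x /span_malgP xP; exists x.
- by move=> x y _ _; apply: zetaFS_bilin_ext (@sprecE R) x y.
- by move=> x y _ _; apply: zetaFS_bilin_ext (@ssuccE R) x y.
- by move=> x y _ _; apply: zetaFS_bilin_ext (@sdotE R) x y.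
Qed.
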